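(* The continuous image of a star Menger space is star Menger: if $X$ is a star Menger space and $f:X\to Y$ is a continuous surjection onto a space $Y$, then $Y$ is star Menger.
   Context: All spaces are assumed to be regular and $T_1$. For a family $\mathcal{U}$ of subsets of $X$ and $A\subseteq X$, $St(A,\mathcal{U})=\bigcup\{U\in\mathcal{U}:U\cap A\neq\emptyset\}$. A space $M$ is Menger if for every sequence $\{\mathcal{U}_n:n\in\omega\}$ of open covers of $M$ there are finite subcollections $\mathcal{V}_n\subseteq\mathcal{U}_n$ ($n\in\omega$) such that $\bigcup\{\mathcal{V}_n:n\in\omega\}$ is an open cover of $M$. A space $X$ is star Menger if for every open cover $\mathcal{U}$ of $X$ there is a subspace $M\subseteq X$ which is Menger and satisfies $St(M,\mathcal{U})=X$. *)

(* Defs.v *)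
From mathcomp Require Import all_boot all_order.
From mathcomp Require Import all_classical topology.

Set Implicit Arguments.
Unset Strict Implicit.
Unset Printing Implicit Defensive.

Local Open Scope classical_set_scope.

Definition star (X : Type) (A : set X) (U : set (set X)) : set X :=
  \bigcup_(u in [set u | U u /\ u `&` A !=set0]) u.

Definition open_cover (X : topologicalType) (U : set (set X)) : Prop :=
  U `<=` open /\ \bigcup_(u in U) u = [set: X].

Definition menger_space (X : topologicalType) : Prop :=
  forall U : nat -> set (set X), (forall n, open_cover (U n)) ->
  exists V : nat -> set (set X),
    (forall n, V n `<=` U n /\ finite_set (V n)) /\
    open_cover (\bigcup_n V n).

(* [set_type M] carries the initial topology of the inclusion into [X], so its
   covers consist of relatively open subsets of [M]. The type [subspace M]
   would be wrong here: its points are those of [X], isolated outside [M]. *)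
Definition star_menger_space (X : topologicalType) : Prop :=
  forall U : set (set X), open_cover U ->
  exists M : set X, menger_space (set_type M) /\ star M U = [set: X].

Arguments menger_space : clear implicits.
Arguments star_menger_space : clear implicits.

(* Main.v *)
Require Import Defs.
From mathcomp Require Import all_boot all_order.
From mathcomp Require Import all_classical topology.

Local Open Scope classical_set_scope.

(** Pull an open cover of [Y] back along [f] and let [M] be a Menger subspace of [X] whose star in
    the pulled-back cover is [X]. The image of [M] is Menger by [menger_set_image]. Its star is all
    of [Y]: if the preimage of [u] contains [x] and meets [M] at [z], then [u] contains [f x] and
    meets the image of [M] at [f z]. *)

Lemma open_cover_preimage (X Y : topologicalType) (f : X -> Y)
    (U : set (set Y)) :
  continuous f -> open_cover U -> open_cover (preimage f @` U).
Proof.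
move=> cf [Uo Uc]; split.
  move=> _ [u Uu <-].
  by apply: open_comp; [move=> x _; exact: cf | exact: Uo].
by rewrite bigcup_image -preimage_bigcup Uc preimage_setT.
Qed.

Lemma menger_space_image (X Y : topologicalType) (f : X -> Y) :
  continuous f -> set_surj [set: X] [set: Y] f ->
  menger_space X -> menger_space Y.
Proof.
move=> cf sf mX U Uc.
have [V [VU [_ Vc]]] :=
  mX _ (fun n => @open_cover_preimage _ _ _ _ cf (Uc n)).
(* By surjectivity, taking images turns each selected preimage back into the member of the cover it
   came from, so no choice of members is needed. *)
have fK (u : set Y) : f @` (f @^-1` u) = u.
  apply/seteqP; split=> [_ [x ux <-]//|y uy].
  by have [x _ fxy] := sf y I; exists x; rewrite //= fxy.
have WU n : image^~ f @` V n `<=` U n.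
  by move=> _ [v Vv <-]; have [u Uu <-] := (VU n).1 _ Vv; rewrite fK.
exists (fun n => image^~ f @` V n); split.
  by move=> n; split; [exact: WU | apply: finite_image; exact: (VU n).2].
split; first by move=> u [n _ /WU/(Uc n).1].
apply/seteqP; split=> // y _; have [x _ <-] := sf y I.
have : [set: X] x by [].
rewrite -Vc => -[v [n _ Vv] vx].
by exists (f @` v); [exists n => //; exists v | exists x].
Qed.

(** Restricting [f] to [M] and corestricting to the image gives a continuous surjection [g] between
    the subspaces, which reduces the claim to [menger_space_image]. *)
Lemma menger_set_image (X Y : topologicalType) (f : X -> Y) (M : set X) :
  continuous f -> menger_space (set_type M) ->
  menger_space (set_type (f @` M)).
Proof.
move=> cf.
have fM (x : set_type M) : f (set_val x) \in f @` M.
  by apply/mem_set; exists (set_val x) => //; exact: set_valP.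
pose g (x : set_type M) : set_type (f @` M) := SigSub (fM x).
apply: (@menger_space_image _ _ g).
  apply/continuousP => _ [A Ao <-].
  (* A relatively open set of the image is the trace of an open [A]; its preimage under [g] is the
     trace on [M] of the preimage of [A] under [f]. *)
  exists (f @^-1` A) => //.
  by apply: open_comp => // x _; exact: cf.
move=> y _; have [x Mx fxy] := set_valP y.
exists (SigSub (mem_set Mx)) => //.
exact: val_inj.
Qed.

Theorem proposition4p13 (X Y : topologicalType)
    (regX : regular_space X) (T1X : accessible_space X)
    (regY : regular_space Y) (T1Y : accessible_space Y)
    (f : X -> Y) (cf : continuous f) (sf : set_surj [set: X] [set: Y] f) :
  star_menger_space X -> star_menger_space Y.
Proof.
move=> sX U Uc.
have [M [mM starM]] := sX _ (open_cover_preimage _ _ _ _ cf Uc).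
exists (f @` M); split; first exact: menger_set_image.
apply/seteqP; split=> // y _; have [x _ <-] := sf y I.
have : [set: X] x by [].
rewrite -starM => -[_ [[u Uu <-] [z [uz Mz]]] ux].
by exists u => //; split=> //; exists (f z); split=> //; exists z.
Qed.
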